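(* (Validity) Let $n\ge 3f+1$ and consider any execution of an instance $\lambda$ of the IBFT algorithm among $n$ processes of which at most $f$ are faulty (Byzantine). Given an externally provided predicate $\beta$, if a correct process decides some value $v$, then $\beta(v)$ is true.
   Context: **System model.** There is a known set $\Pi=\{p_1,\dots,p_n\}$ of processes. A process following the algorithm is correct; otherwise it is faulty and may behave arbitrarily (Byzantine). At most $f$ processes are faulty, and $n\ge 3f+1$. The system is partially synchronous: there are an unknown bound $\Delta$ on execution and communication delays and an unknown time GST after which the bound holds. Messages sent before GST may be arbitrarily delayed or lost; a message sent by a correct process at time $t\ge$ GST is delivered by all correct processes (to which it is sent) by time $t+\Delta$. Broadcasting means sending to every process in $\Pi$, including oneself. **Messages.** For an instance $\lambda$, messages are $\langle\texttt{PRE-PREPARE},\lambda,r,v\rangle$, $\langle\texttt{PREPARE},\lambda,r,v\rangle$, $\langle\texttt{COMMIT},\lambda,r,v\rangle$ ($r$ a round, $v$ a value), and $\langle\texttt{ROUND-CHANGE},\lambda,r,pr,pv\rangle$ ($pr$ a prepared round, $pv$ a prepared value, both possibly $\bot$). A correct process accepts only valid messages. A message is valid if it carries an unforgeable proof of integrity and of its sender's identity (e.g. a digital signature), an externally provided predicate $\beta$ is true of the value it carries (if that value is not $\bot$), and, for $\langle\texttt{ROUND-CHANGE},\lambda,r,pr,pv\rangle$, $pr<r$ (or $pr=\bot$). Here $\bot$ is a default marker used only in the $pr,pv$ fields and is not a value. A quorum of messages is a set of messages from $\lfloor\frac{n+f}{2}\rfloor+1$ different processes. A deterministic function $\mathrm{LEADER}(\lambda,r)\in\Pi$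 gives the leader of round $r$. **State of a correct process $p_i$.** Instance $\lambda_i$; current round $r_i$; prepared round $pr_i$ and prepared value $pv_i$; input value $inputValue_i$; a timer. The timeout $t(r)$ is an exponential function of $r$. **Start($\lambda$, value).** Set $\lambda_i\gets\lambda$, $r_i\gets1$, $pr_i\gets\bot$, $pv_i\gets\bot$, $inputValue_i\gets value$. If $\mathrm{LEADER}(\lambda_i,r_i)=p_i$, broadcast $\langle\texttt{PRE-PREPARE},\lambda_i,r_i,inputValue_i\rangle$. Start the timer to expire after $t(r_i)$. **Upon rules** (each triggered at most once for any round $r_i$, except Rule 7, which may be triggered any number of times): 1. Upon receiving from $\mathrm{LEADER}(\lambda_i,r_i)$ a valid message $m=\langle\texttt{PRE-PREPARE},\lambda_i,r_i,v\rangle$ with $\mathrm{JustifyPrePrepare}(m)$ true: restart the timer to expire after $t(r_i)$ and broadcast $\langle\texttt{PREPARE},\lambda_i,r_i,v\rangle$. 2. Upon receiving a quorum of valid $\langle\texttt{PREPARE},\lambda_i,r_i,v\rangle$ messages (same $v$): set $pr_i\gets r_i$, $pv_i\gets v$, and broadcast $\langle\texttt{COMMIT},\lambda_i,r_i,v\rangle$. When this happens we say that $p_i$ prepares (has prepared) for round $r_i$ and value $v$. 3. Upon receiving a quorum $Q_{commit}$ of valid $\langle\texttt{COMMIT},\lambda_i,round,v\rangle$ messages (same $round$ and $v$; $round$ need not equal $r_i$): stop the timer and decide $v$. 4. Upon the timer expiring: set $r_i\gets r_i+1$, start the timer to expire after $t(r_i)$, broadcast $\langle\texttt{ROUND-CHANGE},\lambda_i,r_i,pr_i,pv_i\rangle$.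 5. Upon receiving valid ROUND-CHANGE messages for $\lambda_i$ from $f+1$ different processes, all with rounds $>r_i$: set $r_i$ to the smallest of these rounds, start the timer to expire after $t(r_i)$, broadcast $\langle\texttt{ROUND-CHANGE},\lambda_i,r_i,pr_i,pv_i\rangle$. 6. Upon receiving a quorum $Q_{rc}$ of valid $\langle\texttt{ROUND-CHANGE},\lambda_i,r_i,\cdot,\cdot\rangle$ messages with $\mathrm{LEADER}(\lambda_i,r_i)=p_i$ and $\mathrm{JustifyRoundChange}(Q_{rc})$ true: if some message in $Q_{rc}$ has prepared round $\ne\bot$, let $v$ be the value component of $\mathrm{HighestPrepared}(Q_{rc})$; otherwise let $v=inputValue_i$; broadcast $\langle\texttt{PRE-PREPARE},\lambda_i,r_i,v\rangle$. 7. Upon receiving a valid ROUND-CHANGE message for $\lambda_i$ from $p_j$, if $p_i$ has decided with quorum $Q_{commit}$: send $Q_{commit}$ to $p_j$. **Justification.** $\mathrm{HighestPrepared}(Q_{rc})$ is a pair $(pr,pv)$ occurring as prepared round and value of a message in $Q_{rc}$ whose prepared round is highest (every message in $Q_{rc}$ has prepared round $\bot$ or $\le pr$). $\mathrm{JustifyRoundChange}(Q_{rc})$ is true iff all messages in $Q_{rc}$ have prepared round and prepared value $\bot$, or the evaluating process has received a quorum of valid $\langle\texttt{PREPARE},\lambda,pr,pv\rangle$ messages with $(pr,pv)=\mathrm{HighestPrepared}(Q_{rc})$. $\mathrm{JustifyPrePrepare}(\langle\texttt{PRE-PREPARE},\lambda,r,v\rangle)$ is true iff $r=1$, or the evaluating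 process has received a quorum $Q_{rc}$ of valid $\langle\texttt{ROUND-CHANGE},\lambda,r,pr_j,pv_j\rangle$ messages such that either all of them have $pr_j=\bot$ and $pv_j=\bot$, or the process has received a quorum of valid $\langle\texttt{PREPARE},\lambda,pr,v\rangle$ messages with $(pr,v)=\mathrm{HighestPrepared}(Q_{rc})$. The messages serving as justification are piggybacked on the message they justify, and count as received by the recipient. *)

(* Defs.v *)
From Stdlib Require List.
From mathcomp Require Import all_boot all_order all_algebra.
From mathcomp Require Import reals.

Set Implicit Arguments.
Unset Strict Implicit.
Unset Printing Implicit Defensive.

Import Order.TTheory GRing.Theory Num.Theory.

(* Processes are the elements of ['I_n], rounds are natural
   numbers (the first round is 1), and [None] plays the role of the marker
   "bottom" of the prepared round and prepared value of a ROUND-CHANGE.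
   Finite sets of messages are represented by sequences. *)

Inductive content (Inst Value : Type) : Type :=
| PrePrepare (lam : Inst) (r : nat) (v : Value)
| Prepare (lam : Inst) (r : nat) (v : Value)
| Commit (lam : Inst) (r : nat) (v : Value)
| RoundChange (lam : Inst) (r : nat) (pr : option nat) (pv : option Value).

Definition instance_of {Inst Value : Type} (c : content Inst Value) : Inst :=
  match c with
  | PrePrepare lam _ _ | Prepare lam _ _ | Commit lam _ _
  | RoundChange lam _ _ _ => lam
  end.

Definition carried_value {Inst Value : Type} (c : content Inst Value) :
    option Value :=
  match c with
  | PrePrepare _ _ v | Prepare _ _ v | Commit _ _ v => Some v
  | RoundChange _ _ _ pv => pv
  end.

(* [sender] is the claimed author of the message, backed by [proof]; it need not
   be the process that transmits it (messages are piggybacked and forwarded). *)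
Record message (n : nat) (Inst Value Sig : Type) : Type := Message {
  sender : 'I_n;
  body : content Inst Value;
  proof : Sig }.

Definition prepared_fields {n : nat} {Inst Value Sig : Type}
    (m : message n Inst Value Sig) : option (option nat * option Value) :=
  if body m is RoundChange _ _ pr pv then Some (pr, pv) else None.

Definition is_highest_prepared {n : nat} {Inst Value Sig : Type}
    (Q : seq (message n Inst Value Sig)) (hp : option nat * option Value) :
    Prop :=
  (exists2 m, List.In m Q & prepared_fields m = Some hp) /\
  (forall m pr pv, List.In m Q -> prepared_fields m = Some (Some pr, pv) ->
     exists2 hr, hp.1 = Some hr & pr <= hr).

(* The externally provided data of the protocol.  [highest_prepared] is an
   arbitrary function meeting its specification, since a set of ROUND-CHANGE
   messages may contain several pairs with the highest prepared round. *)
Record protocol (R : realType) (n : nat) (Inst Value Sig : Type) : Type :=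
Protocol {
  leader : Inst -> nat -> 'I_n;
  timeout : nat -> R;
  timeout_exponential : exists a b : R,
    [/\ (0 < a)%R, (1 < b)%R & forall r, timeout r = (a * b ^+ r)%R];
  verify : message n Inst Value Sig -> Prop;
  sign : 'I_n -> content Inst Value -> Sig;
  verify_sign : forall p c, verify (Message p c (sign p c));
  highest_prepared :
    seq (message n Inst Value Sig) -> option nat * option Value;
  highest_preparedP : forall Q,
    (exists2 m, List.In m Q & prepared_fields m <> None) ->
    is_highest_prepared Q (highest_prepared Q) }.

(* The rules that are triggered at most once for any round; the remaining rule,
   which sends the quorum of a decision, is the event [Help] below. *)
Inductive rule : Type :=
| OnPrePrepare
| OnPrepareQuorum
| OnCommitQuorum
| OnTimerExpired
| OnHigherRoundChanges
| OnRoundChangeQuorum.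

Section Model.
Variables (R : realType) (n f : nat) (Inst Value Sig : Type).
Variables (beta : Value -> Prop) (P : protocol R n Inst Value Sig).

Local Notation pid := 'I_n.
Local Notation msg := (message n Inst Value Sig).
(* What is transmitted at once: a message with the messages piggybacked on it,
   or a forwarded quorum. *)
Local Notation packet := (seq msg).
(* Destination and packet. *)
Local Notation output := (seq ('I_n * seq (message n Inst Value Sig))).

Definition valid (m : msg) : Prop :=
  [/\ verify P m,
      forall v, carried_value (body m) = Some v -> beta v
    & forall lam r pr pv,
        body m = RoundChange lam r (Some pr) pv -> pr < r].

Definition quorum (Q : seq msg) : Prop :=
  size Q = (n + f) %/ 2 + 1 /\ uniq [seq sender m | m <- Q].

(* [ps_inst] and [ps_input] are [None] before Start.  [ps_timer] is the expiry
   time of the timer, [None] when it is stopped.  [ps_fired] records which rules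
   have been triggered and in which round; [ps_decided] lists the decided
   values, each with the quorum of COMMIT messages it was decided with. *)
Record pstate : Type := PState {
  ps_inst : option Inst;
  ps_round : nat;
  ps_pr : option nat;
  ps_pv : option Value;
  ps_input : option Value;
  ps_timer : option R;
  ps_rcvd : seq msg;
  ps_fired : seq (rule * nat);
  ps_decided : seq (Value * seq msg) }.

Definition init_state : pstate :=
  PState None 0 None None None None [::] [::] [::].

Definition start_state (lam : Inst) (v : Value) (tm : option R) (s : pstate) :=
  PState (Some lam) 1 None None (Some v) tm
    (ps_rcvd s) (ps_fired s) (ps_decided s).

Definition set_timer (tm : option R) (s : pstate) :=
  PState (ps_inst s) (ps_round s) (ps_pr s) (ps_pv s) (ps_input s) tm
    (ps_rcvd s) (ps_fired s) (ps_decided s).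

Definition set_round (r : nat) (s : pstate) :=
  PState (ps_inst s) r (ps_pr s) (ps_pv s) (ps_input s) (ps_timer s)
    (ps_rcvd s) (ps_fired s) (ps_decided s).

Definition set_prepared (r : nat) (v : Value) (s : pstate) :=
  PState (ps_inst s) (ps_round s) (Some r) (Some v) (ps_input s) (ps_timer s)
    (ps_rcvd s) (ps_fired s) (ps_decided s).

Definition add_received (pkt : packet) (s : pstate) :=
  PState (ps_inst s) (ps_round s) (ps_pr s) (ps_pv s) (ps_input s) (ps_timer s)
    (pkt ++ ps_rcvd s) (ps_fired s) (ps_decided s).

Definition add_decision (v : Value) (Q : seq msg) (s : pstate) :=
  PState (ps_inst s) (ps_round s) (ps_pr s) (ps_pv s) (ps_input s) (ps_timer s)
    (ps_rcvd s) (ps_fired s) ((v, Q) :: ps_decided s).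

Definition mark_fired (rho : rule) (s : pstate) :=
  PState (ps_inst s) (ps_round s) (ps_pr s) (ps_pv s) (ps_input s) (ps_timer s)
    (ps_rcvd s) ((rho, ps_round s) :: ps_fired s) (ps_decided s).

Definition can_fire (rho : rule) (s : pstate) : Prop :=
  ~ List.In (rho, ps_round s) (ps_fired s).

Definition accepted (s : pstate) (m : msg) : Prop :=
  List.In m (ps_rcvd s) /\ valid m.

Definition quorum_of (s : pstate) (c : content Inst Value) (Q : seq msg) :
    Prop :=
  quorum Q /\ (forall m, List.In m Q -> accepted s m /\ body m = c).

Definition round_change_quorum (s : pstate) (lam : Inst) (r : nat)
    (Q : seq msg) : Prop :=
  quorum Q /\
  (forall m, List.In m Q ->
     accepted s m /\ exists pr pv, body m = RoundChange lam r pr pv).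

Definition all_bottom (Q : seq msg) : Prop :=
  forall m, List.In m Q -> prepared_fields m = Some (None, None).

(* [J] consists of the PREPARE messages that make JustifyRoundChange true. *)
Definition round_change_justification (s : pstate) (lam : Inst)
    (Q J : seq msg) : Prop :=
  (all_bottom Q /\ J = [::]) \/
  (exists pr pv, highest_prepared P Q = (Some pr, Some pv) /\
     quorum_of s (Prepare lam pr pv) J).

Definition justify_round_change (s : pstate) (lam : Inst) (Q : seq msg) :
    Prop :=
  exists J, round_change_justification s lam Q J.

Definition justify_pre_prepare (s : pstate) (lam : Inst) (r : nat)
    (v : Value) : Prop :=
  r = 1 \/
  (exists Q, round_change_quorum s lam r Q /\
     (all_bottom Q \/
      exists pr J, highest_prepared P Q = (Some pr, Some v) /\
        quorum_of s (Prepare lam pr v) J)).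

(* The messages piggybacked on the ROUND-CHANGE messages of a process. *)
Definition prepared_certificate (s : pstate) (lam : Inst) (J : seq msg) :
    Prop :=
  match ps_pr s, ps_pv s with
  | Some pr, Some pv => quorum_of s (Prepare lam pr pv) J
  | _, _ => J = [::]
  end.

(* [v] is the value that a leader proposes on the basis of [Q]. *)
Definition proposal (s : pstate) (Q : seq msg) (v : Value) : Prop :=
  let some_prepared := exists m pr pv,
    List.In m Q /\ prepared_fields m = Some (Some pr, pv) in
  (some_prepared -> (highest_prepared P Q).2 = Some v) /\
  (~ some_prepared -> ps_input s = Some v).

Definition broadcast (p : pid) (c : content Inst Value) (J : seq msg) :
    output :=
  [seq (q, Message p c (sign P p c) :: J) | q <- enum 'I_n].

(* [upon now p s rho s' out]: at time [now], process [p] in state [s] triggers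
   rule [rho], moves to state [s'] and sends the packets [out]. *)
Inductive upon (now : R) (p : pid) (s : pstate) :
    rule -> pstate -> output -> Prop :=
| upon_pre_prepare lam m v :
    ps_inst s = Some lam -> can_fire OnPrePrepare s ->
    accepted s m -> sender m = leader P lam (ps_round s) ->
    body m = PrePrepare lam (ps_round s) v ->
    justify_pre_prepare s lam (ps_round s) v ->
    upon now p s OnPrePrepare
      (set_timer (Some (now + timeout P (ps_round s))%R)
         (mark_fired OnPrePrepare s))
      (broadcast p (Prepare lam (ps_round s) v) [::])
| upon_prepare_quorum lam v Q :
    ps_inst s = Some lam -> can_fire OnPrepareQuorum s ->
    quorum_of s (Prepare lam (ps_round s) v) Q ->
    upon now p s OnPrepareQuorum
      (set_prepared (ps_round s) v (mark_fired OnPrepareQuorum s))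
      (broadcast p (Commit lam (ps_round s) v) [::])
| upon_commit_quorum lam round v Q :
    ps_inst s = Some lam -> can_fire OnCommitQuorum s ->
    quorum_of s (Commit lam round v) Q ->
    upon now p s OnCommitQuorum
      (add_decision v Q (set_timer None (mark_fired OnCommitQuorum s)))
      [::]
| upon_timer_expired lam e J :
    ps_inst s = Some lam -> can_fire OnTimerExpired s ->
    ps_timer s = Some e -> (e <= now)%R ->
    prepared_certificate s lam J ->
    upon now p s OnTimerExpired
      (set_timer (Some (now + timeout P (ps_round s).+1)%R)
         (set_round (ps_round s).+1 (mark_fired OnTimerExpired s)))
      (broadcast p
         (RoundChange lam (ps_round s).+1 (ps_pr s) (ps_pv s)) J)
| upon_higher_round_changes lam F rmin J :
    ps_inst s = Some lam -> can_fire OnHigherRoundChanges s ->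
    size F = f + 1 -> uniq [seq sender m | m <- F] ->
    (forall m, List.In m F -> accepted s m /\
       exists r pr pv, [/\ body m = RoundChange lam r pr pv,
                           ps_round s < r & rmin <= r]) ->
    (exists m pr pv, List.In m F /\ body m = RoundChange lam rmin pr pv) ->
    prepared_certificate s lam J ->
    upon now p s OnHigherRoundChanges
      (set_timer (Some (now + timeout P rmin)%R)
         (set_round rmin (mark_fired OnHigherRoundChanges s)))
      (broadcast p (RoundChange lam rmin (ps_pr s) (ps_pv s)) J)
| upon_round_change_quorum lam Q J v :
    ps_inst s = Some lam -> can_fire OnRoundChangeQuorum s ->
    round_change_quorum s lam (ps_round s) Q ->
    leader P lam (ps_round s) = p ->
    justify_round_change s lam Q ->
    round_change_justification s lam Q J ->
    proposal s Q v ->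
    upon now p s OnRoundChangeQuorum
      (mark_fired OnRoundChangeQuorum s)
      (broadcast p (PrePrepare lam (ps_round s) v) (Q ++ J)).

Definition enabled (now : R) (p : pid) (s : pstate) (rho : rule) : Prop :=
  exists s' out, upon now p s rho s' out.

(* [Receive q pkt]: a packet transmitted by [q] is delivered.  [Help q]: a
   quorum of a decision is sent to [q], upon a ROUND-CHANGE of [q]. *)
Inductive event : Type :=
| Idle
| Start (v : Value)
| Receive (q : pid) (pkt : packet)
| Upon (rho : rule)
| Help (q : pid).

Inductive correct_step (lam : Inst) (now : R) (p : pid) (s : pstate) :
    event -> pstate -> output -> Prop :=
| step_idle : correct_step lam now p s Idle s [::]
| step_start v :
    ps_inst s = None ->
    correct_step lam now p s (Start v)
      (start_state lam v (Some (now + timeout P 1)%R) s)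
      (if leader P lam 1 == p then broadcast p (PrePrepare lam 1 v) [::]
       else [::])
| step_receive q pkt :
    correct_step lam now p s (Receive q pkt) (add_received pkt s) [::]
| step_upon rho s' out :
    upon now p s rho s' out ->
    correct_step lam now p s (Upon rho) s' out
| step_help lam_i m r pr pv v Q :
    ps_inst s = Some lam_i ->
    accepted s m -> body m = RoundChange lam_i r pr pv ->
    List.In (v, Q) (ps_decided s) ->
    correct_step lam now p s (Help (sender m)) s [:: (sender m, Q)].

(* A timed run: the [k]-th step is taken at time [ex_time k] by process
   [ex_actor k]; it leads from [ex_state k] to [ex_state k.+1] and transmits
   [ex_out k].  States and events of faulty processes are meaningless. *)
Record execution : Type := Execution {
  ex_time : nat -> R;
  ex_state : nat -> pid -> pstate;
  ex_actor : nat -> pid;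
  ex_event : nat -> event;
  ex_out : nat -> output }.

Definition transmits (E : execution) (k : nat) (p q : pid) (pkt : packet) :
    Prop :=
  ex_actor E k = p /\ List.In (q, pkt) (ex_out E k).

Definition receives (E : execution) (k : nat) (q p : pid) (pkt : packet) :
    Prop :=
  ex_actor E k = p /\ ex_event E k = Receive q pkt.

Definition time_progresses (E : execution) : Prop :=
  {homo ex_time E : j k / j <= k >-> (j <= k)%R} /\
  (forall T : R, exists k, (T < ex_time E k)%R).

Definition follows_algorithm (faulty : {set pid}) (lam : Inst)
    (E : execution) : Prop :=
  forall p, p \notin faulty ->
    ex_state E 0 p = init_state /\
    forall k,
      if ex_actor E k == p then
        correct_step lam (ex_time E k) p (ex_state E k p) (ex_event E k)
          (ex_state E k.+1 p) (ex_out E k)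
      else ex_state E k.+1 p = ex_state E k p.

(* Correct processes only receive what was transmitted to them; a packet may
   a priori be lost, delayed, reordered or duplicated. *)
Definition network_integrity (faulty : {set pid}) (E : execution) : Prop :=
  forall k q p pkt, p \notin faulty -> receives E k q p pkt ->
    exists2 j, j < k & transmits E j q p pkt.

(* Faulty processes send anything, except messages of the instance under
   consideration that bear a proof of authorship of a correct process that never
   sent them.  Messages of other instances are left unconstrained, as correct
   processes may run these instances too. *)
Definition unforgeability (faulty : {set pid}) (lam : Inst)
    (E : execution) : Prop :=
  forall k p q pkt m, p \in faulty -> transmits E k p q pkt ->
    List.In m pkt -> verify P m -> sender m \notin faulty ->
    instance_of (body m) = lam ->
    exists j q' pkt' m', [/\ j < k, transmits E j (sender m) q' pkt',
      List.In m' pkt', sender m' = sender m & body m' = body m].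

Definition bounded_communication (faulty : {set pid}) (E : execution)
    (GST Delta : R) : Prop :=
  forall j p q pkt, p \notin faulty -> q \notin faulty ->
    transmits E j p q pkt -> (GST <= ex_time E j)%R ->
    exists i, [/\ j < i, receives E i p q pkt
                & (ex_time E i <= ex_time E j + Delta)%R].

(* After GST, no rule of a correct process stays enabled for more than [Delta]
   without being triggered.  [ex_state E j.+1] is the state reached at time
   [ex_time E j].  The first clause covers the rules whose enabledness does not
   depend on the current time; a process that has already decided is not obliged
   to decide again.  The other two clauses are about an expired timer and about
   sending the quorum of a decision. *)
Definition bounded_execution (faulty : {set pid}) (E : execution)
    (GST Delta : R) : Prop :=
  forall p, p \notin faulty ->
  [/\ forall rho j k, rho <> OnTimerExpired -> j < k ->
        (Num.max (ex_time E j) GST + Delta < ex_time E k)%R ->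
        exists i, j < i <= k /\
          [\/ ~ enabled (ex_time E i) p (ex_state E i p) rho,
              rho = OnCommitQuorum /\ ps_decided (ex_state E i p) <> [::] |
              [/\ i < k, ex_actor E i = p & ex_event E i = Upon rho]],
      forall k e, ps_timer (ex_state E k p) = Some e ->
        (ex_time E k <= Num.max e GST + Delta)%R
    & forall j k q pkt m lam_i r pr pv,
        receives E j q p pkt -> List.In m pkt -> valid m ->
        ps_inst (ex_state E j p) = Some lam_i ->
        body m = RoundChange lam_i r pr pv ->
        ps_decided (ex_state E j p) <> [::] ->
        (Num.max (ex_time E j) GST + Delta < ex_time E k)%R ->
        exists i, [/\ j < i < k, ex_actor E i = p
                    & ex_event E i = Help (sender m)]].

Definition partially_synchronous (faulty : {set pid}) (E : execution) : Prop :=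
  exists GST Delta : R, [/\ (0 < Delta)%R,
    bounded_communication faulty E GST Delta
    & bounded_execution faulty E GST Delta].

Definition ibft_execution (faulty : {set pid}) (lam : Inst)
    (E : execution) : Prop :=
  [/\ time_progresses E, follows_algorithm faulty lam E,
      network_integrity faulty E, unforgeability faulty lam E
    & partially_synchronous faulty E].

Definition decides (E : execution) (p : pid) (v : Value) : Prop :=
  exists k Q, List.In (v, Q) (ps_decided (ex_state E k p)).

End Model.

(* Main.v *)
(* A decision requires a quorum of accepted COMMIT messages; a quorum is not
   empty, and a valid message only carries a value satisfying [beta]. *)
Require Import Defs.
From mathcomp Require Import all_boot all_order all_algebra.
From mathcomp Require Import reals.

(** Validity is a local invariant of each correct process: every value in [ps_decided] satisfies
    [beta]. Only the COMMIT-quorum rule adds an entry, and [quorum_of_carried_value] applies to it;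
    [correct_step_decided] thus preserves the invariant along the run. *)

Lemma quorum_of_carried_value (R : realType) (n f : nat)
    (Inst Value Sig : Type) (beta : Value -> Prop)
    (P : protocol R n Inst Value Sig) (s : pstate R n Inst Value Sig)
    (c : content Inst Value) (Q : seq (message n Inst Value Sig)) (v : Value) :
  quorum_of f beta P s c Q -> carried_value c = Some v -> beta v.
Proof.
(* The [+ 1] in the quorum size rules out an empty [Q]; one member is enough. *)
case: Q => [|m Q] [[sizeQ _] inQ] cv; first by rewrite addn1 in sizeQ.
have [[_ [_ beta_m _]] body_m] := inQ m (or_introl erefl).
by apply: beta_m; rewrite body_m.
Qed.

Lemma correct_step_decided (R : realType) (n f : nat)
    (Inst Value Sig : Type) (beta : Value -> Prop)
    (P : protocol R n Inst Value Sig) (lam : Inst) (now : R) (p : 'I_n)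
    (s s' : pstate R n Inst Value Sig) (e : event n Inst Value Sig)
    (out : seq ('I_n * seq (message n Inst Value Sig))) :
  correct_step f beta P lam now p s e s' out ->
  (forall v Q, List.In (v, Q) (ps_decided s) -> beta v) ->
  forall v Q, List.In (v, Q) (ps_decided s') -> beta v.
Proof.
(* All other events and rules leave [ps_decided] unchanged, so [//] closes them. *)
case=> // rho {}s' {}out; case=> // lam_i round v Q _ _ commitQ IHs w Q'.
case=> [[<- _]|]; last exact: IHs.
exact: quorum_of_carried_value commitQ erefl.
Qed.

Theorem theorem4 (R : realType) (n f : nat) (Inst Value Sig : Type)
    (beta : Value -> Prop) (P : protocol R n Inst Value Sig)
    (faulty : {set 'I_n}) (lam : Inst)
    (E : execution R n Inst Value Sig) :
  3 * f + 1 <= n ->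
  #|faulty| <= f ->
  ibft_execution f beta P faulty lam E ->
  forall (p : 'I_n) (v : Value),
    p \notin faulty -> decides E p v -> beta v.
Proof.
move=> _ _ [_ followE _ _ _] p v /followE[init0 stepE] [k [Q]].
(* [v] and [Q] are generalized: the invariant covers all recorded decisions. *)
elim: k v Q => [|k IHk]; first by rewrite init0.
have := stepE k; case: ifP => [_ step_k|_ ->]; last exact: IHk.
exact: correct_step_decided step_k IHk.
Qed.
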